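(* Let $X$ and $Y$ be digital images. Any punctuated homotopy $H:X\times[0,k]_{\mathbb Z}\to Y$ is a strong homotopy.
   Context: A digital image is a set $X$ together with a symmetric, antireflexive adjacency relation (equivalently, a simple graph). Write $x\leftrightarrow x'$ for ''adjacent'' and $x\mathrel{\underline{\leftrightarrow}} x'$ for ''adjacent or equal''. A function $f:X\to Y$ between digital images is continuous if $x\leftrightarrow x'$ implies $f(x)\mathrel{\underline{\leftrightarrow}} f(x')$. For integers $a\le b$, $[a,b]_{\mathbb Z}=\{a,a+1,\dots,b\}$, with adjacency $c_1$: $s,t$ are adjacent iff $|s-t|=1$. A homotopy is a function $H:X\times[0,k]_{\mathbb Z}\to Y$ ($k$ a positive integer) such that $t\mapsto H(x,t)$ is continuous for each fixed $x\in X$ and $x\mapsto H(x,t)$ is continuous for each fixed $t\in[0,k]_{\mathbb Z}$. A strong homotopy is a function $H:X\times[0,k]_{\mathbb Z}\to Y$ which is continuous with respect to the $\mathrm{NP}_2$ adjacency on the domain, in which two distinct points $(x,t),(x',t')$ are adjacent iff $x\mathrel{\underline{\leftrightarrow}} x'$ and $t\mathrel{\underline{\leftrightarrow}} t'$. A homotopy $H:X\times[0,k]_{\mathbb Z}\to Y$ is punctuated if for each $t$ with $0\le t<k$ there is some $x_t\in X$ such that $H(x,t)=H(x,t+1)$ for all $x\neq x_t$. *)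

(* Defs.v *)
From Corelib Require Import RelationClasses.
From mathcomp Require Import all_boot all_order all_algebra.
Set Implicit Arguments.
Unset Strict Implicit.
Unset Printing Implicit Defensive.
Import Order.TTheory GRing.Theory Num.Theory.
Local Open Scope ring_scope.

(* The carrier is an arbitrary type, not assumed finite or with decidable
   equality, and adjacency is Prop-valued. *)
Record digital_image := DigitalImage {
  points :> Type;
  adj : points -> points -> Prop;
  adj_sym : Symmetric adj;
  adj_irr : Irreflexive adj
}.

Definition adjeq (X : digital_image) (x x' : X) : Prop := adj x x' \/ x = x'.

Definition digitally_continuous (X Y : digital_image) (f : X -> Y) : Prop :=
  forall x x' : X, adj x x' -> adjeq (f x) (f x').

Section Interval.
Variables a b : int.

Definition itv_pt := {t : int | a <= t <= b}.

Definition c1_adj (s t : itv_pt) : Prop := `|val s - val t| = 1.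

Lemma c1_adj_sym : Symmetric c1_adj.
Proof. by move=> s t; rewrite /c1_adj distrC. Qed.

Lemma c1_adj_irr : Irreflexive c1_adj.
Proof. by move=> s; rewrite /complement /c1_adj subrr normr0. Qed.

Definition Zinterval : digital_image := DigitalImage c1_adj_sym c1_adj_irr.

End Interval.

Section NP2.
Variables X Y : digital_image.

Definition NP2_adj (p q : X * Y) : Prop :=
  p <> q /\ adjeq p.1 q.1 /\ adjeq p.2 q.2.

Lemma adjeq_sym (Z : digital_image) (z z' : Z) : adjeq z z' -> adjeq z' z.
Proof. by case=> [/adj_sym|->]; [left|right]. Qed.

Lemma NP2_adj_sym : Symmetric NP2_adj.
Proof.
move=> p q [npq [h1 h2]]; split; first by move=> e; apply: npq.
by split; apply: adjeq_sym.
Qed.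

Lemma NP2_adj_irr : Irreflexive NP2_adj.
Proof. by move=> p [npp _]; apply: npp. Qed.

Definition NP2 : digital_image := DigitalImage NP2_adj_sym NP2_adj_irr.

End NP2.

Section Homotopy.
Variables (X Y : digital_image) (k : int).
Implicit Type H : X * Zinterval 0 k -> Y.

Definition is_homotopy H : Prop :=
  (forall x : X, digitally_continuous (fun t : Zinterval 0 k => H (x, t))) /\
  (forall t : Zinterval 0 k, digitally_continuous (fun x : X => H (x, t))).

Definition is_strong_homotopy H : Prop :=
  @digitally_continuous (NP2 X (Zinterval 0 k)) Y H.

(* The pairs (t, t') of points of [0, k] with t' = t + 1 are exactly the
   pairs (t, t + 1) with 0 <= t < k. *)
Definition is_punctuated H : Prop :=
  forall t t' : Zinterval 0 k, val t' = val t + 1 ->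
  exists xt : X, forall x : X, x <> xt -> H (x, t) = H (x, t').

Definition is_punctuated_homotopy H : Prop := is_homotopy H /\ is_punctuated H.

End Homotopy.

(* Main.v *)
(* For adjacent x, x', at most one of them is the point that moves between
   times t and t + 1; the other one is stationary, so the diagonal step from
   (x, t) to (x', t + 1) can be replaced by a step at constant time. *)
From Stdlib Require Import Classical_Prop.
Require Import Defs.
From mathcomp Require Import all_boot all_order all_algebra.
From mathcomp Require Import zify.
Local Open Scope ring_scope.

Lemma c1_adj_cases (a b : int) (s t : Zinterval a b) :
  adj s t -> val t = val s + 1 \/ val s = val t + 1.
Proof. by case: s t => [s ?] [t ?]; rewrite /= /c1_adj /=; lia. Qed.

Lemma punctuated_step (X Y : digital_image) (k : int)
    (H : X * Zinterval 0 k -> Y) (x x' : X) (t t' : Zinterval 0 k) :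
  is_punctuated_homotopy H -> adj x x' -> val t' = val t + 1 ->
  adjeq (H (x, t)) (H (x', t')).
Proof.
move=> [[_ Hx] Hp] xx' tt'; have [xt Hxt] := Hp t t' tt'.
(* Equality on [X] may be undecidable, hence excluded middle. If [x] is stationary, the step takes
   place at time [t']. *)
case: (classic (x = xt)) => [x_xt|/Hxt ->]; last exact: Hx.
(* Here [x] moves, so [x'] is stationary by irreflexivity, and the step takes place at time [t]. *)
rewrite -(Hxt x'); first exact: Hx.
by move=> x'_xt; move: xx'; rewrite x_xt x'_xt => /(adj_irr (x := xt)).
Qed.

Theorem theorem3p1 (X Y : digital_image) (k : int) (hk : 0 < k)
    (H : X * Zinterval 0 k -> Y) :
  is_punctuated_homotopy H -> is_strong_homotopy H.
Proof.
move=> HP; have [[Ht Hx] _] := HP.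
move=> [x t] [x' t'] [neq /= [[xx'|->] [tt'|ett']]].
- case: (c1_adj_cases _ _ _ _ tt') => step; first exact: punctuated_step.
  (* Time decreases here, so the diagonal is traversed backwards, from [(x', t')] to [(x, t)]. *)
  by apply/adjeq_sym/punctuated_step => //; apply: adj_sym.
- by rewrite ett'; apply: Hx.
- exact: Ht.
- by rewrite ett'; right.
Qed.
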